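(* Let $\mathrm{ML}$ be the sequent calculus for minimal logic described in the context. Then: 1. Double negation elimination implies ex falso and tertium non datur over $\mathrm{ML}$. 2. Ex falso together with tertium non datur imply double negation elimination over $\mathrm{ML}$. 3. Ex falso does not imply tertium non datur over $\mathrm{ML}$. 4. Tertium non datur does not imply ex falso over $\mathrm{ML}$. 5. Tertium non datur does not imply double negation elimination over $\mathrm{ML}$.
   Context: Fix a first-order language without equality (with at least one predicate symbol, and infinitely many free variables, kept syntactically separate from bound variables). Formulas are built from atomic formulas with $\neg,\land,\lor,\supset,\forall,\exists$ ($\neg$ is primitive). A sequent is $\Gamma\rightarrow\Delta$ with $\Gamma$ a finite (possibly empty) sequence of formulas and $\Delta$ empty or a single formula. $\mathrm{ML}$ is Gentzen's intuitionistic calculus LJ without the rule weakening:right (from $\Gamma\rightarrow$ infer $\Gamma\rightarrow D$). Its initial sequents are $D\rightarrow D$ for all formulas $D$. Its rules ($\Delta,\Lambda$ denote at most one formula) are: - weakening:left: from $\Gamma\rightarrow\Delta$ infer $D,\Gamma\rightarrow\Delta$; contraction:left: from $D,D,\Gamma\rightarrow\Delta$ infer $D,\Gamma\rightarrow\Delta$; exchange:left: from $\Gamma,C,D,\Pi\rightarrow\Delta$ infer $\Gamma,D,C,\Pi\rightarrow\Delta$; - cut: from $\Gamma\rightarrow D$ and $D,\Pi\rightarrow\Lambda$ infer $\Gamma,\Pi\rightarrow\Lambda$; - $\neg$:left: from $\Gamma\rightarrow A$ infer $\neg A,\Gamma\rightarrow$; $\neg$:right: from $A,\Gamma\rightarrow$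 infer $\Gamma\rightarrow\neg A$; - $\land$:left: from $A,\Gamma\rightarrow\Delta$, or from $B,\Gamma\rightarrow\Delta$, infer $A\land B,\Gamma\rightarrow\Delta$; $\land$:right: from $\Gamma\rightarrow A$ and $\Gamma\rightarrow B$ infer $\Gamma\rightarrow A\land B$; - $\lor$:left: from $A,\Gamma\rightarrow\Delta$ and $B,\Gamma\rightarrow\Delta$ infer $A\lor B,\Gamma\rightarrow\Delta$; $\lor$:right: from $\Gamma\rightarrow A$, or from $\Gamma\rightarrow B$, infer $\Gamma\rightarrow A\lor B$; - $\supset$:left: from $\Gamma\rightarrow A$ and $B,\Pi\rightarrow\Lambda$ infer $A\supset B,\Gamma,\Pi\rightarrow\Lambda$; $\supset$:right: from $A,\Gamma\rightarrow B$ infer $\Gamma\rightarrow A\supset B$; - $\forall$:left: from $A(t),\Gamma\rightarrow\Delta$ infer $\forall x A(x),\Gamma\rightarrow\Delta$ ($t$ any term); $\forall$:right: from $\Gamma\rightarrow A(a)$ infer $\Gamma\rightarrow\forall xA(x)$, the free variable $a$ not occurring in the conclusion; - $\exists$:left: from $A(a),\Gamma\rightarrow\Delta$ infer $\exists xA(x),\Gamma\rightarrow\Delta$, the free variable $a$ not occurring in the conclusion; $\exists$:right: from $\Gamma\rightarrow A(t)$ infer $\Gamma\rightarrow\exists xA(x)$ ($t$ any term). The principles are schemas, ranging over all formulas $A,B$: ex falso is $\neg A\supset(A\supset B)$; tertium non datur is $A\lor\neg A$; double negation elimination is $\neg\neg A\supset A$. A collection of these principles implies a principle $Q$ over $\mathrm{ML}$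 if, when for every instance $F$ of the principles in the collection the sequent $\rightarrow F$ is added to $\mathrm{ML}$ as an initial sequent, the sequent $\rightarrow G$ becomes derivable for every instance $G$ of $Q$. *)

(* Defs.v *)
From mathcomp Require Import all_boot.
From Stdlib Require List.

Set Implicit Arguments.
Unset Strict Implicit.
Unset Printing Implicit Defensive.

Record language := Language {
  free_var : Type;
  free_var_infinite : exists f : nat -> free_var, injective f;
  fun_symb : Type;
  fun_arity : fun_symb -> nat;
  pred_symb : Type;
  pred_arity : pred_symb -> nat;
  pred_symb_inhabited : inhabited pred_symb
}.

(* Free variables are named and bound variables are de Bruijn indices, so the
   two are syntactically separate and formulas are taken up to renaming of
   bound variables.  [term L n] and [form L n] are the semi-terms and
   semi-formulas whose dangling bound variables are among n; terms and formulas
   proper are the case n = 0. *)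
Inductive term (L : language) (n : nat) : Type :=
| FVar of free_var L
| BVar of 'I_n
| App (f : fun_symb L) of {ffun 'I_(fun_arity f) -> term L n}.

Arguments FVar {L n} _.
Arguments BVar {L n} _.
Arguments App {L n} f _.

Inductive form (L : language) : nat -> Type :=
| Atom n (p : pred_symb L) of {ffun 'I_(pred_arity p) -> term L n} : form L n
| Neg n of form L n : form L n
| And n of form L n & form L n : form L n
| Or n of form L n & form L n : form L n
| Imp n of form L n & form L n : form L n
| All n of form L n.+1 : form L n
| Ex n of form L n.+1 : form L n.

Arguments Atom {L n} p _.

Notation formula L := (form L 0).

Fixpoint tsubst (L : language) (m n : nat) (s : 'I_m -> term L n)
    (t : term L m) : term L n :=
  match t with
  | FVar a => FVar a
  | BVar i => s i
  | App f ts => App f [ffun i => tsubst s (ts i)]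
  end.

(* The substitution to be used under a quantifier: index 0 is the newly bound
   variable, and the values of [s] are shifted past it. *)
Definition lift_subst (L : language) (m n : nat) (s : 'I_m -> term L n)
    (i : 'I_m.+1) : term L n.+1 :=
  match unlift ord0 i with
  | None => BVar ord0
  | Some j => tsubst (fun k => BVar (lift ord0 k)) (s j)
  end.

Fixpoint fsubst (L : language) (m : nat) (A : form L m) :
    forall n : nat, ('I_m -> term L n) -> form L n :=
  match A in form _ m return forall n, ('I_m -> term L n) -> form L n with
  | Atom _ p ts => fun n s => Atom p [ffun i => tsubst s (ts i)]
  | Neg _ A => fun n s => Neg (fsubst A s)
  | And _ A B => fun n s => And (fsubst A s) (fsubst B s)
  | Or _ A B => fun n s => Or (fsubst A s) (fsubst B s)
  | Imp _ A B => fun n s => Imp (fsubst A s) (fsubst B s)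
  | All _ A => fun n s => All (fsubst A (lift_subst s))
  | Ex _ A => fun n s => Ex (fsubst A (lift_subst s))
  end.

(* A(t), for A(x) with at most the bound variable x dangling. *)
Definition inst (L : language) (A : form L 1) (t : term L 0) : formula L :=
  fsubst A (fun=> t).

Fixpoint occurs_term (L : language) (n : nat) (a : free_var L)
    (t : term L n) : Prop :=
  match t with
  | FVar b => b = a
  | BVar _ => False
  | App f ts => exists i, occurs_term a (ts i)
  end.

Fixpoint occurs (L : language) (n : nat) (a : free_var L)
    (A : form L n) : Prop :=
  match A with
  | Atom _ p ts => exists i, occurs_term a (ts i)
  | Neg _ A => occurs a A
  | And _ A B | Or _ A B | Imp _ A B => occurs a A \/ occurs a B
  | All _ A | Ex _ A => occurs a A
  end.

Definition occurs_sequent (L : language) (a : free_var L)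
    (G : seq (formula L)) (D : option (formula L)) : Prop :=
  (exists2 A, List.In A G & occurs a A) \/ (exists2 A, D = Some A & occurs a A).

(* Derivability of the sequent G -> D in ML to which the sequents -> F, for
   F in Ax, are added as initial sequents.  ML itself is the case of empty Ax. *)
Inductive derivable (L : language) (Ax : formula L -> Prop) :
    seq (formula L) -> option (formula L) -> Prop :=
| D_init D : derivable Ax [:: D] (Some D)
| D_axiom F : Ax F -> derivable Ax [::] (Some F)
| D_weakening_left D G X :
    derivable Ax G X -> derivable Ax (D :: G) X
| D_contraction_left D G X :
    derivable Ax (D :: D :: G) X -> derivable Ax (D :: G) X
| D_exchange_left C D G P X :
    derivable Ax (G ++ C :: D :: P) X -> derivable Ax (G ++ D :: C :: P) X
| D_cut D G P X :
    derivable Ax G (Some D) -> derivable Ax (D :: P) X ->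
    derivable Ax (G ++ P) X
| D_neg_left A G :
    derivable Ax G (Some A) -> derivable Ax (Neg A :: G) None
| D_neg_right A G :
    derivable Ax (A :: G) None -> derivable Ax G (Some (Neg A))
| D_and_left1 A B G X :
    derivable Ax (A :: G) X -> derivable Ax (And A B :: G) X
| D_and_left2 A B G X :
    derivable Ax (B :: G) X -> derivable Ax (And A B :: G) X
| D_and_right A B G :
    derivable Ax G (Some A) -> derivable Ax G (Some B) ->
    derivable Ax G (Some (And A B))
| D_or_left A B G X :
    derivable Ax (A :: G) X -> derivable Ax (B :: G) X ->
    derivable Ax (Or A B :: G) X
| D_or_right1 A B G :
    derivable Ax G (Some A) -> derivable Ax G (Some (Or A B))
| D_or_right2 A B G :
    derivable Ax G (Some B) -> derivable Ax G (Some (Or A B))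
| D_imp_left A B G P X :
    derivable Ax G (Some A) -> derivable Ax (B :: P) X ->
    derivable Ax (Imp A B :: G ++ P) X
| D_imp_right A B G :
    derivable Ax (A :: G) (Some B) -> derivable Ax G (Some (Imp A B))
| D_all_left (A : form L 1) (t : term L 0) G X :
    derivable Ax (inst A t :: G) X -> derivable Ax (All A :: G) X
| D_all_right (A : form L 1) (a : free_var L) G :
    ~ occurs_sequent a G (Some (All A)) ->
    derivable Ax G (Some (inst A (FVar a))) -> derivable Ax G (Some (All A))
| D_ex_left (A : form L 1) (a : free_var L) G X :
    ~ occurs_sequent a (Ex A :: G) X ->
    derivable Ax (inst A (FVar a) :: G) X -> derivable Ax (Ex A :: G) X
| D_ex_right (A : form L 1) (t : term L 0) G :
    derivable Ax G (Some (inst A t)) -> derivable Ax G (Some (Ex A)).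

(* A schema is identified with the set of its instances. *)
Definition schema (L : language) : Type := formula L -> Prop.

Definition ex_falso (L : language) : schema L :=
  fun F => exists A B : formula L, F = Imp (Neg A) (Imp A B).

Definition tertium_non_datur (L : language) : schema L :=
  fun F => exists A : formula L, F = Or A (Neg A).

Definition double_negation_elimination (L : language) : schema L :=
  fun F => exists A : formula L, F = Imp (Neg (Neg A)) A.

Definition implies_over_ML (L : language) (C : seq (schema L))
    (Q : schema L) : Prop :=
  forall G, Q G ->
    derivable (fun F => exists2 P : schema L, List.In P C & P F) [::] (Some G).

(* Main.v *)
Require Import Defs.
From mathcomp Require Import all_boot.

Set Implicit Arguments.
Unset Strict Implicit.
Unset Printing Implicit Defensive.

(** The positive parts are short derivations.  Minimal logic refutes
    [Neg (Or A (Neg A))], so double negation elimination yields tertium non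
    datur; and from [A] and [Neg A] it derives the empty succedent, hence
    [Neg (Neg B)] by left weakening and negation introduction, hence [B].
    Conversely, tertium non datur splits the proof of [A] from [Neg (Neg A)]
    into a trivial case and a contradictory one, where ex falso applies.

    The negative parts are by soundness in a finite chain of truth values.
    Minimal logic treats the empty succedent as one more proposition, about
    which nothing is assumed: it may be interpreted by any element [bot] of a
    linear Heyting algebra, with [Neg A] read as the implication from [A] to
    [bot] ([derivable_sound]).  Giving all atoms one common value makes the
    value of a formula invariant under substitution ([value_fsubst]), so
    quantifiers may be read as doing nothing and no domain of individuals is
    needed.  Two choices of values then separate the principles:
    - in the chain 0 < 1 < 2 with [bot] = 0 and atoms of value 1, ex falso holds
      because [bot] is least, while [Or p (Neg p)] has value 1;
    - in the chain 0 < 1 with [bot] = 1 and atoms of value 0, every negation is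
      true, so tertium non datur holds, while ex falso and double negation
      elimination conclude a false atom from true premises. *)

Section Derivations.

Variables (L : language) (Ax : formula L -> Prop).

Lemma derivable_mp (A B : formula L) G :
  derivable Ax [::] (Some (Imp A B)) -> derivable Ax G (Some A) ->
  derivable Ax G (Some B).
Proof.
move=> dAB dA; rewrite -[G]cats0; apply: (D_cut (G := [::]) dAB).
exact: D_imp_left dA (D_init _ _).
Qed.

Lemma derivable_contradiction (A : formula L) :
  derivable Ax [:: A; Neg A] None.
Proof.
apply: (D_exchange_left (G := [::])) => /=.
exact: D_neg_left (D_init _ _).
Qed.

(** The hypothesis [Neg (Or A (Neg A))] is used twice: first against [A], which
    gives [Neg A], then against [Neg A] itself. *)
Lemma derivable_neg_neg_tnd (A : formula L) :
  derivable Ax [::] (Some (Neg (Neg (Or A (Neg A))))).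
Proof.
apply: D_neg_right; apply: D_contraction_left; apply: D_neg_left.
apply: D_or_right2; apply: D_neg_right.
apply: (D_exchange_left (G := [::])) => /=.
apply: D_neg_left; apply: D_or_right1; exact: D_init.
Qed.

Lemma derivable_tnd_of_dne (A : formula L) :
  (forall B, Ax (Imp (Neg (Neg B)) B)) -> derivable Ax [::] (Some (Or A (Neg A))).
Proof.
move=> dne; exact: derivable_mp (D_axiom (dne _)) (derivable_neg_neg_tnd A).
Qed.

Lemma derivable_ex_falso_of_dne (A B : formula L) :
  (forall C, Ax (Imp (Neg (Neg C)) C)) ->
  derivable Ax [::] (Some (Imp (Neg A) (Imp A B))).
Proof.
move=> dne; do 2! apply: D_imp_right.
apply: derivable_mp (D_axiom (dne B)) _; apply: D_neg_right.
exact/D_weakening_left/derivable_contradiction.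
Qed.

Lemma derivable_dne_of_ex_falso_tnd (A : formula L) :
  (forall B C, Ax (Imp (Neg B) (Imp B C))) -> (forall B, Ax (Or B (Neg B))) ->
  derivable Ax [::] (Some (Imp (Neg (Neg A)) A)).
Proof.
move=> efq tnd; apply: D_imp_right.
apply: (D_cut (G := [::]) (D_axiom (tnd A))); apply: D_or_left.
  by apply: (D_exchange_left (G := [::])); apply: D_weakening_left; apply: D_init.
(* Ex falso is applied to the contradictory pair [Neg A], [Neg (Neg A)]. *)
have dimp : derivable Ax [:: Neg (Neg A)] (Some (Imp (Neg A) A)).
  exact: derivable_mp (D_axiom (efq _ _)) (D_init _ _).
apply: (D_exchange_left (G := [::])); apply: (D_cut dimp).
exact: (D_imp_left (P := [::]) (D_init _ _) (D_init _ _)).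
Qed.

End Derivations.

(** Heyting implication in a chain whose greatest element is [top]. *)
Definition chain_imp (top a b : nat) : nat := if a <= b then top else b.

(** Implication is right adjoint to meet; the bound on [k] says that [k] belongs
    to the chain. *)
Lemma leq_chain_imp top a b k :
  k <= top -> (k <= chain_imp top a b) = (minn k a <= b).
Proof.
rewrite /chain_imp geq_min => k_top; case: (leqP a b) => _.
  by rewrite orbT.
by rewrite orbF.
Qed.

Section Soundness.

Variables (L : language) (top bot atom : nat).

Fixpoint value n (A : form L n) : nat :=
  match A with
  | Atom _ _ _ => atom
  | Neg _ A => chain_imp top (value A) bot
  | And _ A B => minn (value A) (value B)
  | Or _ A B => maxn (value A) (value B)
  | Imp _ A B => chain_imp top (value A) (value B)
  | All _ A => value A
  | Ex _ A => value A
  end.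

Lemma value_fsubst m (A : form L m) n (s : 'I_m -> term L n) :
  value (fsubst A s) = value A.
Proof.
elim: A n s => //=
  [m' A IHA|m' A IHA B IHB|m' A IHA B IHB|m' A IHA B IHB] n s;
  by rewrite IHA ?IHB.
Qed.

Definition succedent_value (X : option (formula L)) : nat :=
  if X is Some A then value A else bot.

Definition below (k : nat) (G : seq (formula L)) : bool :=
  all (fun A => k <= value A) G.

(** Being below the meet of the antecedent is tested one [k] at a time, so that
    a sequent says that every [k] forcing the antecedent forces the succedent. *)
Definition valid (G : seq (formula L)) (X : option (formula L)) : Prop :=
  forall k, k <= top -> below k G -> k <= succedent_value X.

Lemma below_cat k G P : below k (G ++ P) = below k G && below k P.
Proof. exact: all_cat. Qed.

Lemma below_leq j k G : j <= k -> below k G -> below j G.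
Proof. by move=> jk; apply: sub_all => A; apply: leq_trans. Qed.

(** Negation and implication introduction both discharge a hypothesis [A] by
    restricting to the truth values below that of [A]. *)
Lemma valid_discharge A G X k :
  valid (A :: G) X -> k <= top -> below k G ->
  k <= chain_imp top (value A) (succedent_value X).
Proof.
move=> vX k_top kG; rewrite leq_chain_imp //; apply: vX.
  exact: leq_trans (geq_minl _ _) k_top.
by rewrite /= geq_minr; apply: below_leq (geq_minl _ _) kG.
Qed.

Lemma derivable_sound (Ax : formula L -> Prop) G X :
  (forall F, Ax F -> top <= value F) -> derivable Ax G X -> valid G X.
Proof.
move=> AxP; elim=> {G X}.
- by move=> D k _ /andP[].
- by move=> F AxF k k_top _; apply: leq_trans k_top (AxP _ AxF).
- by move=> D G X _ IH k k_top /andP[_]; apply: IH.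
- by move=> D G X _ IH k k_top /andP[kD kG]; apply: IH => //=; rewrite kD.
- move=> C D G P X _ IH k k_top; rewrite below_cat /= => kGDCP; apply: IH => //.
  by rewrite below_cat /= [(k <= value C) && _]andbCA.
- move=> D G P X _ IHD _ IHX k k_top; rewrite below_cat => /andP[kG kP].
  by apply: IHX => //=; rewrite (IHD k).
- move=> A G _ IH k k_top /andP[/= kNA kG]; move: kNA.
  by rewrite leq_chain_imp // (minn_idPl (IH k k_top kG)).
- move=> A G _ IH k k_top kG; exact: valid_discharge IH k_top kG.
- move=> A B G X _ IH k k_top /andP[]; rewrite leq_min => /andP[kA _] kG.
  by apply: IH => //=; rewrite kA.
- move=> A B G X _ IH k k_top /andP[]; rewrite leq_min => /andP[_ kB] kG.
  by apply: IH => //=; rewrite kB.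
- move=> A B G _ IHA _ IHB k k_top kG /=.
  by rewrite leq_min [k <= value A]IHA //; apply: IHB.
- move=> A B G X _ IHA _ IHB k k_top /andP[/=].
  rewrite leq_max => /orP[kA|kB] kG; first by apply: IHA => //=; rewrite kA.
  by apply: IHB => //=; rewrite kB.
- by move=> A B G _ IH k k_top kG /=; rewrite leq_max [k <= value A]IH.
- by move=> A B G _ IH k k_top kG /=; rewrite leq_max [k <= value B]IH ?orbT.
- move=> A B G P X _ IHA _ IHX k k_top /= /andP[].
  rewrite leq_chain_imp // below_cat => kAB /andP[kG kP].
  apply: IHX => //=; rewrite kP andbT.
  by rewrite (minn_idPl (IHA k k_top kG)) in kAB.
- move=> A B G _ IH k k_top kG; exact: valid_discharge IH k_top kG.
- move=> A t G X _ IH k k_top kG; apply: IH => //=.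
  by rewrite /inst value_fsubst.
- move=> A a G _ _ IH k k_top kG.
  by move: (IH k k_top kG); rewrite /= /inst value_fsubst.
- move=> A a G X _ _ IH k k_top kG; apply: IH => //=.
  by rewrite /inst value_fsubst.
- move=> A t G _ IH k k_top kG.
  by move: (IH k k_top kG); rewrite /= /inst value_fsubst.
Qed.

Lemma implies_over_ML_sound (P Q : schema L) :
  (forall F, P F -> top <= value F) -> implies_over_ML [:: P] Q ->
  forall F, Q F -> top <= value F.
Proof.
move=> PP PQ F QF; apply: (derivable_sound _ (PQ F QF)) => //.
by move=> E [_ [<-|//]]; apply: PP.
Qed.

End Soundness.

Lemma value_ex_falso (L : language) top atom (F : formula L) :
  ex_falso F -> top <= value top 0 atom F.
Proof.
move=> [A [B ->]] /=; rewrite /chain_imp leqn0.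
by case: eqP => [->|_] /=; rewrite ?if_same.
Qed.

Lemma value_tertium_non_datur (L : language) bot (F : formula L) :
  tertium_non_datur F -> bot <= value bot bot 0 F.
Proof.
by move=> [A ->] /=; rewrite /chain_imp if_same leq_maxr.
Qed.

Theorem theorem1 (L : language) :
  (implies_over_ML [:: @double_negation_elimination L] (@ex_falso L) /\
   implies_over_ML [:: @double_negation_elimination L]
     (@tertium_non_datur L)) /\
  implies_over_ML [:: @ex_falso L; @tertium_non_datur L]
    (@double_negation_elimination L) /\
  ~ implies_over_ML [:: @ex_falso L] (@tertium_non_datur L) /\
  ~ implies_over_ML [:: @tertium_non_datur L] (@ex_falso L) /\
  ~ implies_over_ML [:: @tertium_non_datur L]
    (@double_negation_elimination L).
Proof.
have [f _] := free_var_infinite L; have [q] := pred_symb_inhabited L.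
pose p : formula L := Atom q [ffun=> FVar (f 0)].
split; [split|split; [|split; [|split]]].
- move=> _ [A [B ->]]; apply: derivable_ex_falso_of_dne => C.
  by exists (@double_negation_elimination L); [left | exists C].
- move=> _ [A ->]; apply: derivable_tnd_of_dne => B.
  by exists (@double_negation_elimination L); [left | exists B].
- move=> _ [A ->]; apply: derivable_dne_of_ex_falso_tnd => [B C|B].
    by exists (@ex_falso L); [left | exists B, C].
  by exists (@tertium_non_datur L); [right; left | exists B].
- move/(implies_over_ML_sound (@value_ex_falso L 2 1)).
  by move/(_ _ (ex_intro _ p erefl)).
- move/(implies_over_ML_sound (@value_tertium_non_datur L 1)).
  (* All atoms have the same value, so the true premise [A] of ex falso has to
     be a compound formula. *)
  by move/(_ _ (ex_intro _ (Neg p) (ex_intro _ p erefl))).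
- move/(implies_over_ML_sound (@value_tertium_non_datur L 1)).
  by move/(_ _ (ex_intro _ p erefl)).
Qed.
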